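(* Let $\Omega$ be an atomless Borel probability space with measure $\nu$, and let $(W_n)_n$ be a sequence of graphons on $\Omega$ that converges to a graphon $W:\Omega^2\to[0,1]$ in the cut-norm, i.e. $\|W_n-W\|_\square\to 0$. Let $\mathfrak m$ be a matching in $W$. Then there exists a sequence $(\mathfrak m_n)_n$, where each $\mathfrak m_n$ is a matching in $W_n$, such that $(\mathfrak m_n)_n$ converges to $\mathfrak m$ in the cut-norm, i.e. $\|\mathfrak m_n-\mathfrak m\|_\square\to 0$, and $(\mathfrak m_n)_n$ also converges to $\mathfrak m$ weak$^*$, i.e. $\int_A\mathfrak m_n\,d\nu^{\otimes 2}\to\int_A\mathfrak m\,d\nu^{\otimes 2}$ for every measurable $A\subseteq\Omega^2$.
   Context: A graphon on $\Omega$ is a symmetric measurable function $W:\Omega^2\to[0,1]$. For a function $f$, $\operatorname{supp} f=\{f\neq 0\}$. A matching in a graphon $W$ is a function $\mathfrak m\in L^1(\Omega^2)$ (not necessarily symmetric) such that (M1) $\mathfrak m\ge 0$ almost everywhere; (M2) $\operatorname{supp}\mathfrak m\subseteq\operatorname{supp}W$ up to a null set; (M3) for almost every $x\in\Omega$, $\int_\Omega\mathfrak m(x,y)\,d\nu(y)+\int_\Omega\mathfrak m(y,x)\,d\nu(y)\le 1$. The cut-norm of $U\in L^1(\Omega^2)$ is $\|U\|_\square=\sup_{S,T}\left|\int_{S\times T}U\,d\nu^{\otimes 2}\right|$, where the supremum is over all measurable $S,T\subseteq\Omega$. *)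

(* Defs.v *)
From mathcomp Require Import all_boot all_order all_algebra.
From mathcomp Require Import all_classical all_reals all_analysis.

Set Implicit Arguments.
Unset Strict Implicit.
Unset Printing Implicit Defensive.

Import Order.TTheory GRing.Theory Num.Theory.
Import numFieldNormedType.Exports.

Local Open Scope classical_set_scope.
Local Open Scope ring_scope.

Definition polish (R : realType) (X : metricType R) : Prop :=
  (exists2 D : set X, countable D & dense D) /\
  (forall F : set_system X, ProperFilter F -> cauchy F ->
     exists l : X, F --> l).

(* The metric is carried by a second type [X], in bijection with [T], because
   [T] itself comes with a sigma-algebra only. *)
Definition standard_borel (R : realType) (d : measure_display)
    (T : measurableType d) : Prop :=
  exists X : metricType R, polish X /\
  exists2 f : T -> X, bijective f &
    forall A : set T, measurable A <-> <<s [set U : set X | open U] >> (f @` A).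

Definition atomless (R : realType) (d : measure_display)
    (T : measurableType d) (nu : set T -> \bar R) : Prop :=
  forall A : set T, measurable A -> (0 < nu A)%E ->
    exists B : set T,
      [/\ measurable B, B `<=` A, (0 < nu B)%E & (nu B < nu A)%E].

Definition supp (R : realType) (T : Type) (f : T -> R) : set T :=
  [set z | f z != 0].

Definition graphon (R : realType) (d : measure_display) (T : measurableType d)
    (W : T * T -> R) : Prop :=
  [/\ measurable_fun setT W,
      forall x y : T, W (x, y) = W (y, x) &
      forall z : T * T, 0 <= W z <= 1].

Definition matching (R : realType) (d : measure_display) (T : measurableType d)
    (nu : probability T R) (W : T * T -> R) (m : T * T -> R) : Prop :=
  [/\ (nu \x nu)%E.-integrable setT (EFin \o m),
      {ae (nu \x nu)%E, forall z, 0 <= m z},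
      (nu \x nu)%E.-negligible (supp m `\` supp W) &
      {ae nu, forall x,
        (\int[nu]_y (m (x, y))%:E + \int[nu]_y (m (y, x))%:E <= 1)%E}].

Definition cut_norm (R : realType) (d : measure_display)
    (T : measurableType d) (nu : probability T R) (U : T * T -> R) : \bar R :=
  ereal_sup [set r : \bar R | exists A B : set T,
    [/\ measurable A, measurable B &
        r = `| \int[(nu \x nu)%E]_(z in A `*` B) (U z)%:E |%E]].

(* Main.v *)
Require Import Defs.
From mathcomp Require Import all_boot all_order all_algebra.
From mathcomp Require Import all_classical all_reals all_analysis.
From mathcomp Require Import measurable_realfun lra.

(* Rescale the matching: [m * Wn / W] is supported in [supp Wn].  With the
   quotient regularized to [f_k = |m| / (W + 1 / (k + 1))], which is integrable,
   [f_k * Wn] tends to [f_k * W] in the cut norm, because multiplication by a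
   fixed integrable function preserves convergence to 0 in the cut norm among
   kernels bounded by 1; and [f_k * W] tends to [m] in L1.  Choosing for each [n]
   the index [k <= n] that minimizes the cut distance of [g_n = f_k * Wn] to [m]
   makes that distance tend to 0.  The excess over 1 of the degrees of [g_n] is
   the integral of [g_n] over [S * T] and [T * S] minus the mass of [S], where
   [S] is the set of points of degree > 1; as [m] is a matching, it is at most
   twice the cut distance from [g_n] to [m].  Dividing [g_n (x, y)] by
   [max 1 (degree x) * max 1 (degree y)] thus gives a matching at a vanishing L1
   distance from [g_n]. *)

Set Implicit Arguments.
Unset Strict Implicit.
Unset Printing Implicit Defensive.

Import Order.TTheory GRing.Theory Num.Theory.
Import numFieldNormedType.Exports.

Local Open Scope classical_set_scope.
Local Open Scope ring_scope.

Lemma measurable_fun_invr (R : realType) (d : measure_display)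
    (T : measurableType d) (f : T -> R) (e : R) : 0 < e ->
  (forall x, e <= f x) -> measurable_fun setT f ->
  measurable_fun setT (fun x => (f x)^-1).
Proof.
move=> e0 fe mf.
(* Inversion is discontinuous at 0. Truncating below at [e] leaves [f] unchanged and makes the
   inverse continuous on the whole line. *)
have -> : (fun x => (f x)^-1) = (fun t => (Num.max e t)^-1) \o f.
  by apply/funext => x /=; rewrite (max_idPr (fe x)).
apply: measurableT_comp mf; apply: continuous_measurable_fun => t.
have e_neq0 : Num.max e t != 0 by rewrite gt_eqF// lt_max e0.
by apply: cvgV => //; apply: (@continuous_max _ _ (cst e) id t);
  [exact: cvg_cst|exact: cvg_id].
Qed.

(** * Integrable real functions and the L1 norm *)

Section L1.
Context {R : realType} {d : measure_display} {T : measurableType d}.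
Variable mu : {measure set T -> \bar R}.
Implicit Types f g h : T -> R.

Definition L1 f := mu.-integrable setT (EFin \o f).

Definition L1norm f : R := \int[mu]_x `|f x|.

Lemma L1_measurable f : L1 f -> measurable_fun setT f.
Proof. by move=> /(measurable_int mu) /measurable_EFinP. Qed.

Lemma L1D f g : L1 f -> L1 g -> L1 (f \+ g).
Proof. by move=> If Ig; exact: (integrableD measurableT If Ig). Qed.

Lemma L1B f g : L1 f -> L1 g -> L1 (f \- g).
Proof. by move=> If Ig; exact: (integrableB measurableT If Ig). Qed.

Lemma L1Z (c : R) f : L1 f -> L1 (fun x => c * f x).
Proof. by move=> If; exact: (integrableZl measurableT c If). Qed.

Lemma L1_dominated f g : measurable_fun setT f ->
  (forall x, `|f x| <= g x) -> L1 g -> L1 f.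
Proof.
move=> mf fg Ig; apply: (le_integrable measurableT _ _ Ig).
  exact/measurable_EFinP.
by move=> x _; rewrite !abse_EFin lee_fin (le_trans (fg x))// ler_norm.
Qed.

Lemma L1_norm f : L1 f -> L1 (fun x => `|f x|).
Proof.
move=> If; have mf := L1_measurable If.
apply: (le_integrable measurableT _ _ If).
  by apply/measurable_EFinP; exact: measurableT_comp.
by move=> x _; rewrite !abse_EFin normr_id.
Qed.

Lemma L1M f g : L1 f -> measurable_fun setT g -> (forall x, `|g x| <= 1) ->
  L1 (f \* g).
Proof.
move=> If mg g1; apply: (@L1_dominated _ (fun x => `|f x|)); last exact: L1_norm.
  by apply: measurable_funM => //; exact: L1_measurable.
by move=> x /=; rewrite normrM ler_piMr.
Qed.

Lemma L1norm_ge0 f : 0 <= L1norm f.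
Proof. by apply: Rintegral_ge0 => x _. Qed.

Lemma L1normB f g : L1norm (f \- g) = L1norm (g \- f).
Proof. by apply: eq_Rintegral => x _ /=; rewrite distrC. Qed.

Lemma ler_L1norm f g : L1 f -> L1 g -> (forall x, `|f x| <= `|g x|) ->
  L1norm f <= L1norm g.
Proof. by move=> If Ig fg; apply: le_Rintegral => //; exact: L1_norm. Qed.

Lemma normr_Rintegral_le_L1norm f (A : set T) : measurable A -> L1 f ->
  `|\int[mu]_(x in A) f x| <= L1norm f.
Proof.
move=> mA If.
have IfA : mu.-integrable A (EFin \o f) by exact: integrableS If.
have InfA : mu.-integrable A (EFin \o (fun x => `|f x|)).
  by apply: integrableS (L1_norm If).
apply: (le_trans (le_normr_Rintegral mA IfA)).
rewrite Rintegral_mkcond; apply: le_Rintegral => //.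
- by rewrite -restrict_EFin; exact/(integrable_mkcond _ mA).
- exact: L1_norm.
- by move=> x _; rewrite patchE; case: ifP => // _; exact: normr_ge0.
Qed.

Lemma L1_dominated_cvg (fn : nat -> T -> R) f g :
  (forall n, measurable_fun setT (fn n)) -> measurable_fun setT f ->
  (forall n x, `|fn n x| <= g x) -> L1 g ->
  {ae mu, forall x, fn n x @[n --> \oo] --> f x} ->
  L1norm (fn n \- f) @[n --> \oo] --> 0.
Proof.
move=> mfn mf fng Ig fnf.
have [] := @dominated_convergence _ _ _ mu setT measurableT
  (fun n => EFin \o fn n) (EFin \o f) (EFin \o g) _ _ _ Ig _.
- by move=> n; exact/measurable_EFinP.
- exact/measurable_EFinP.
- apply: filterS fnf => x fx _; apply: cvg_EFin; last exact: fx.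
  by apply: nearW.
- by apply: aeW => x n _; rewrite abse_EFin lee_fin.
- by move=> _ /fine_cvg.
Qed.

End L1.

(** * The cut norm of integrable kernels, as a real number *)

Section cut.
Context {R : realType} {d : measure_display} {T : measurableType d}.
Variable nu : probability T R.
Local Notation mu := (nu \x nu)%E.
Implicit Types U V : T * T -> R.

(* Inference finds that [nu \x nu] is a finite measure only through its structure
   of probability. *)
Let P : probability (T * T)%type R := (nu \x nu)%E.

Lemma L1_indic (E : set (T * T)) : measurable E -> L1 mu \1_E.
Proof. exact: (integrable_indic P). Qed.

Lemma L1_cst (c : R) : L1 mu (cst c).
Proof.
exact: (finite_measure_integrable_cst P c).
Qed.

(** [fine] would send an infinite cut norm to 0; [cut_normE] excludes this case for integrable
    kernels. *)
Definition cut U : R := fine (cut_norm nu U).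

Lemma cut_norm_le U (e : R) : L1 mu U ->
  (forall A B : set T, measurable A -> measurable B ->
     `|\int[mu]_(z in A `*` B) U z| <= e) ->
  (cut_norm nu U <= e%:E)%E.
Proof.
move=> IU Ue; apply: ge_ereal_sup => _ [A [B [mA mB ->]]].
have mAB : measurable (A `*` B) by exact: measurableX.
by rewrite -EFin_normr_Rintegral ?lee_fin ?Ue//; exact: integrableS IU.
Qed.

Lemma le_cut_norm U (A B : set T) : L1 mu U -> measurable A -> measurable B ->
  (`|\int[mu]_(z in A `*` B) U z|%:E <= cut_norm nu U)%E.
Proof.
move=> IU mA mB; apply: ereal_sup_ubound; exists A, B; split => //.
have mAB : measurable (A `*` B) by exact: measurableX.
by rewrite -EFin_normr_Rintegral//; exact: integrableS IU.
Qed.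

Lemma cut_norm_ge0 U : (0 <= cut_norm nu U)%E.
Proof.
apply: (@le_trans _ _ `|\int[mu]_(z in set0 `*` set0) (U z)%:E|%E) => //.
by apply: ereal_sup_ubound; exists set0, set0.
Qed.

Lemma cut_normE U : L1 mu U -> cut_norm nu U = (cut U)%:E.
Proof.
move=> IU; rewrite fineK// ge0_fin_numE ?cut_norm_ge0//.
apply: (le_lt_trans _ (ltry (L1norm mu U))); apply: cut_norm_le => // A B mA mB.
by apply: normr_Rintegral_le_L1norm => //; exact: measurableX.
Qed.

Lemma cut_ge0 U : 0 <= cut U.
Proof. by apply: fine_ge0; exact: cut_norm_ge0. Qed.

Lemma cut_le U (e : R) : L1 mu U ->
  (forall A B : set T, measurable A -> measurable B ->
     `|\int[mu]_(z in A `*` B) U z| <= e) ->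
  cut U <= e.
Proof. by move=> IU Ue; rewrite -lee_fin -cut_normE//; exact: cut_norm_le. Qed.

Lemma le_cut U (A B : set T) : L1 mu U -> measurable A -> measurable B ->
  `|\int[mu]_(z in A `*` B) U z| <= cut U.
Proof. by move=> IU mA mB; rewrite -lee_fin -cut_normE//; exact: le_cut_norm. Qed.

Lemma cut_le_L1norm U : L1 mu U -> cut U <= L1norm mu U.
Proof.
move=> IU; apply: cut_le => // A B mA mB.
by apply: normr_Rintegral_le_L1norm => //; exact: measurableX.
Qed.

Lemma ler_cutD U V : L1 mu U -> L1 mu V -> cut (U \+ V) <= cut U + cut V.
Proof.
move=> IU IV; apply: cut_le => [|A B mA mB]; first exact: L1D.
have mAB : measurable (A `*` B) by exact: measurableX.
rewrite RintegralD//; [|exact: integrableS IU|exact: integrableS IV].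
by rewrite (le_trans (ler_normD _ _))// lerD//; exact: le_cut.
Qed.

Lemma ler_cutZ (c : R) U : L1 mu U -> cut (fun z => c * U z) <= `|c| * cut U.
Proof.
move=> IU; apply: cut_le => [|A B mA mB]; first exact: L1Z.
have mAB : measurable (A `*` B) by exact: measurableX.
rewrite RintegralZl//; last exact: integrableS IU.
by rewrite normrM ler_wpM2l//; exact: le_cut.
Qed.

Lemma Rintegral_indicM (E B : set (T * T)) U : measurable E -> measurable B ->
  \int[mu]_(z in B) (\1_E z * U z) = \int[mu]_(z in B `&` E) U z.
Proof.
move=> mE mB; rewrite Rintegral_mkcondr; apply: eq_Rintegral => z _.
rewrite patchE indicE; case: ifP => _; by rewrite ?mul1r ?mul0r.
Qed.

(** The intersection of two rectangles is a rectangle, so every test of the restricted kernel is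
    already a test of [U]. *)
Lemma ler_cut_rect U (A B : set T) : L1 mu U -> measurable A -> measurable B ->
  cut (\1_(A `*` B) \* U) <= cut U.
Proof.
move=> IU mA mB; have mAB : measurable (A `*` B) by exact: measurableX.
have -> : \1_(A `*` B) \* U = U \* \1_(A `*` B).
  by apply/funext => z /=; rewrite mulrC.
apply: cut_le => [|C D mC mD].
  apply: L1M => //.
  by move=> z; rewrite indicE; case: (_ \in _); rewrite ?normr0 ?normr1.
under eq_Rintegral do rewrite /= mulrC.
rewrite Rintegral_indicM//; last exact: measurableX.
have -> : C `*` D `&` A `*` B = (C `&` A) `*` (D `&` B).
  by apply/seteqP; split => [[x y]/= [[? ?] []]|[x y]/= [[? ?] []]].
by apply: le_cut => //; exact: measurableI.
Qed.

End cut.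

(** * Multiplication by a fixed integrable function and cut convergence to 0 *)

Section multiplier.
Context {R : realType} {d : measure_display} {T : measurableType d}.
Variable nu : probability T R.
Local Notation mu := (nu \x nu)%E.
Variable U : nat -> T * T -> R.
Hypothesis mU : forall n, measurable_fun setT (U n).
Hypothesis U1 : forall n z, `|U n z| <= 1.
Hypothesis U0 : cut nu (U n) @[n --> \oo] --> 0.
Implicit Types f g : T * T -> R.

(** This class is enlarged in steps: indicators of rectangles, indicators of measurable sets by a
    Dynkin argument, simple functions by linearity, and all of L1 by density. *)
Let multiplier f := L1 mu f /\ cut nu (f \* U n) @[n --> \oo] --> 0.

Let L1MU f n : L1 mu f -> L1 mu (f \* U n).
Proof. by move=> If; exact: L1M. Qed.

Let multiplier_le f (g : nat -> R) : L1 mu f ->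
  (forall n, cut nu (f \* U n) <= g n) -> g n @[n --> \oo] --> 0 ->
  multiplier f.
Proof.
move=> If fg g0; split => //; apply: squeeze_cvgr (cvg_cst 0) g0.
by apply: nearW => n; rewrite cut_ge0 fg.
Qed.

Let multiplierD f g : multiplier f -> multiplier g -> multiplier (f \+ g).
Proof.
move=> [If f0] [Ig g0].
apply: (@multiplier_le _ (fun n => cut nu (f \* U n) + cut nu (g \* U n))).
- exact: L1D.
- move=> n; have -> : (f \+ g) \* U n = (f \* U n) \+ (g \* U n).
    by apply/funext => z /=; rewrite mulrDl.
  by apply: ler_cutD; exact: L1MU.
- by rewrite -[0]addr0; exact: cvgD.
Qed.

Let multiplierZ (c : R) f : multiplier f -> multiplier (fun z => c * f z).
Proof.
move=> [If f0].
apply: (@multiplier_le _ (fun n => `|c| * cut nu (f \* U n))).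
- exact: L1Z.
- move=> n; have -> : (fun z => c * f z) \* U n = (fun z => c * (f \* U n) z).
    by apply/funext => z /=; rewrite mulrA.
  by apply: ler_cutZ; exact: L1MU.
- by rewrite -(mulr0 `|c|); apply: cvgMr.
Qed.

(** Since [U n] is bounded by 1, replacing [f] by [g] changes the product by at most
    [L1norm mu (f \- g)] in the cut norm, uniformly in [n]. *)
Let multiplier_closed f : L1 mu f ->
  (forall e, 0 < e -> exists2 g, multiplier g & L1norm mu (f \- g) <= e) ->
  multiplier f.
Proof.
move=> If fg; split => //; apply/cvgr0Pnorm_le => e e0.
have e2 : 0 < e / 2 by rewrite divr_gt0.
have [g [Ig /cvgr0Pnorm_le/(_ _ e2) gU0] fge] := fg _ e2.
apply: filterS gU0 => n; rewrite !ger0_norm ?cut_ge0// => gUn.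
have -> : f \* U n = (g \* U n) \+ ((f \- g) \* U n).
  by apply/funext => z /=; rewrite mulrBl addrC subrK.
have Ifg : L1 mu (f \- g) by exact: L1B.
rewrite (le_trans (ler_cutD _ _))//; [exact: L1MU|exact: L1MU|].
rewrite (splitr e) lerD// (le_trans _ fge)//.
rewrite (le_trans (cut_le_L1norm _))//; first exact: L1MU.
by apply: ler_L1norm => //; [exact: L1MU|move=> z /=; rewrite normrM ler_piMr].
Qed.

Let multiplier_rect (A B : set T) : measurable A -> measurable B ->
  multiplier \1_(A `*` B).
Proof.
move=> mA mB; apply: (@multiplier_le _ (fun n => cut nu (U n))) => //.
- by apply: L1_indic; exact: measurableX.
- move=> n; apply: ler_cut_rect => //.
  rewrite (_ : U n = cst 1 \* U n); last by apply/funext => z /=; rewrite mul1r.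
  by apply: L1MU; exact: L1_cst.
Qed.

Let multiplier_cst (c : R) : multiplier (cst c).
Proof.
have -> : cst c = (fun z => c * \1_(setT `*` setT) z) :> (T * T -> R).
  by apply/funext => z /=; rewrite setXTT indicT mulr1.
by apply: multiplierZ; exact: multiplier_rect.
Qed.

Let multiplier_bigcup (F : (set (T * T))^nat) : (forall n, measurable (F n)) ->
  trivIset setT F -> (forall n, multiplier \1_(F n)) ->
  multiplier \1_(\bigcup_n F n).
Proof.
move=> mF tF F_mult.
have mS n : measurable (\big[setU/set0]_(k < n) F k).
  by apply: bigsetU_measurable.
have S_mult n : multiplier \1_(\big[setU/set0]_(k < n) F k).
  elim: n => [|n IH].
    by rewrite big_ord0 indic0; exact: multiplier_cst.
  rewrite big_ord_recr/=; move: (multiplierD IH (F_mult n)).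
  congr multiplier; apply/funext => z; rewrite /= !indicE in_setU.
  have [zn|zn] := boolP (z \in F n); last by rewrite addr0 orbF.
  have [zS|zS] := boolP (z \in _); last by rewrite add0r.
  exfalso; move: zS zn; rewrite !inE -bigcup_mkord => -[k /= kn Fkz] Fnz.
  have /trivIsetP/(_ k n I I) := tF.
  rewrite (ltn_eqF kn) => /(_ isT) => FF0.
  by have : (F k `&` F n) z by []; rewrite FF0.
(* Finite unions follow from additivity on disjoint sets; by dominated convergence their indicators
   tend in L1 to that of the countable union. *)
have mbF : measurable (\bigcup_n F n) by exact: bigcup_measurable.
apply: multiplier_closed => [|e e0]; first exact: L1_indic.
have : L1norm mu (\1_(\big[setU/set0]_(k < n) F k) \- \1_(\bigcup_n F n))
    @[n --> \oo] --> 0.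
  apply: (@L1_dominated_cvg _ _ _ _ _ _ (cst 1)).
  - by move=> n; exact: measurable_indic.
  - exact: measurable_indic.
  - by move=> n z; rewrite indicE; case: (_ \in _); rewrite ?normr0 ?normr1.
  - exact: L1_cst.
  - apply: aeW => z.
    have [[k _ Fkz]|zF] := pselect ((\bigcup_n F n) z).
      apply: cvg_near_cst; exists k.+1 => // n /= kn.
      rewrite !indicE !mem_set//; first by exists k.
      by rewrite -bigcup_mkord; exists k.
    rewrite (_ : (fun n => _) = cst (\1_(\bigcup_n F n) z)); first exact: cvg_cst.
    apply/funext => n /=; rewrite !indicE !memNset// => zn; apply: zF.
    by move: zn; rewrite -bigcup_mkord => -[k _ Fkz]; exists k.
move=> /cvgr0Pnorm_le/(_ _ e0)[N _ /(_ N (leqnn N))].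
rewrite /= ger0_norm ?L1norm_ge0// L1normB => Ne.
by exists \1_(\big[setU/set0]_(k < N) F k).
Qed.

(** Rectangles are closed under intersection and generate the product sigma-algebra, and the sets
    whose indicator is a multiplier form a Dynkin class. *)
Let multiplier_indic (E : set (T * T)) : measurable E -> multiplier \1_E.
Proof.
have prodE := @measurable_prod_measurableType _ _ T T.
rewrite prodE; move: E; apply: (dynkin_induction prodE).
- move=> _ _ [A mA [B mB <-]] [C mC [D mD <-]]; rewrite -setXI.
  by exists (A `&` C); [exact: measurableI|exists (B `&` D) => //; exact: measurableI].
- by rewrite -setXTT; exact: multiplier_rect.
- by move=> _ [A mA [B mB <-]]; exact: multiplier_rect.
- move=> S _ S_mult.
  have -> : \1_(~` S) = cst 1 \+ (fun z => (-1) * \1_S z) :> (T * T -> R).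
    apply/funext => z; rewrite /= !indicE in_setC.
    by case: (z \in S); rewrite /= ?mulr1 ?mulr0 ?subrr ?addr0.
  by apply: multiplierD; [exact: multiplier_cst|exact: multiplierZ].
- exact: multiplier_bigcup.
Qed.

Import HBSimple.

Lemma cvg_cut_multiplier f : L1 mu f -> cut nu (f \* U n) @[n --> \oo] --> 0.
Proof.
move=> If; suff [] : multiplier f by [].
apply: multiplier_closed => // e e0.
have [g [Ig _ /fine_cvg/cvgr0Pnorm_le/(_ _ e0)]] :=
  approximation_sfun_integrable measurableT If.
move=> [N _ /(_ N (leqnn N))]; rewrite /= => fg; exists (g N); last first.
  by apply: le_trans fg; rewrite ler_norm.
have -> : (g N : T * T -> R) = (fun z => \sum_(y \in range (g N))
    y * \1_(g N @^-1` [set y]) z).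
  by apply/funext => z; rewrite fimfunE.
have gfin : finite_set (range (g N)) by exact: fimfunP.
under eq_fun do rewrite (fsbig_finite _ _ gfin).
elim: (finmap.enum_fset _) => [|y s IH].
  by under eq_fun do rewrite big_nil; exact: multiplier_cst.
under eq_fun do rewrite big_cons.
apply: multiplierD => //; apply: multiplierZ; apply: multiplier_indic.
exact: measurable_sfunP.
Qed.

(** The indicator of [A] is absorbed into the multiplier; what remains is an integral over the full
    square, a rectangle that the cut norm controls. This is the source of the weak* convergence. *)
Lemma cvg_Rintegral_multiplier f (A : set (T * T)) : L1 mu f -> measurable A ->
  \int[mu]_(z in A) (f z * U n z) @[n --> \oo] --> 0.
Proof.
move=> If mA.
have IAf : L1 mu (f \* \1_A).
  apply: L1M => //.
  by move=> z; rewrite indicE; case: (_ \in _); rewrite ?normr0 ?normr1.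
apply/norm_cvg0P; apply: squeeze_cvgr (cvg_cst 0) (cvg_cut_multiplier IAf).
apply: nearW => n; rewrite normr_ge0 /=.
have -> : \int[mu]_(z in A) (f z * U n z) =
    \int[mu]_(z in setT `*` setT) ((f \* \1_A) \* U n) z.
  rewrite setXTT -[X in Rintegral _ X _](setTI A) -Rintegral_indicM//.
  by apply: eq_Rintegral => z _ /=; rewrite mulrCA mulrA.
by apply: le_cut => //; exact: L1MU.
Qed.

End multiplier.

(** * Degrees of a kernel, and rounding a kernel to degrees at most 1 *)

Section degree.
Context {R : realType} {d : measure_display} {T : measurableType d}.
Variable nu : probability T R.
Local Notation mu := (nu \x nu)%E.
Implicit Types (b : T -> R) (g m : T * T -> R) (S : set T).
Local Open Scope ereal_scope.

(** The left-hand side of (M3), which thus reads [degree m x <= 1] for almost every [x]. *)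
Definition degree g (x : T) : \bar R :=
  \int[nu]_y (g (x, y))%:E + \int[nu]_y (g (y, x))%:E.

Lemma measurable_degree g : measurable_fun setT g -> (forall z, 0 <= g z)%R ->
  measurable_fun setT (degree g).
Proof.
move=> mg g0; have mEg : measurable_fun setT (EFin \o g).
  exact/measurable_EFinP.
apply: emeasurable_funD.
- by apply: (measurable_fun_fubini_tonelli_F (EFin \o g)) => // z; rewrite lee_fin.
- by apply: (measurable_fun_fubini_tonelli_G (EFin \o g)) => // z; rewrite lee_fin.
Qed.

Lemma degree_ge0 g x : (forall z, 0 <= g z)%R -> 0 <= degree g x.
Proof. by move=> g0; apply: adde_ge0; apply: integral_ge0 => y _; rewrite lee_fin. Qed.

(** Double counting by Tonelli: the weight at the first endpoint meets the row integrals, the weight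
    at the second the column integrals, and the two add up to the degree. *)
Lemma integral_degree b g : measurable_fun setT b -> (forall x, 0 <= b x)%R ->
  measurable_fun setT g -> (forall z, 0 <= g z)%R ->
  \int[mu]_z (b z.1 * g z)%:E + \int[mu]_z (b z.2 * g z)%:E =
  \int[nu]_x ((b x)%:E * degree g x).
Proof.
move=> mb b0 mg g0; have mEg : measurable_fun setT (EFin \o g).
  exact/measurable_EFinP.
have mEb : measurable_fun setT (EFin \o b) by exact/measurable_EFinP.
have g1 x : measurable_fun setT (fun y => (g (x, y))%:E).
  by apply: (measurableT_comp mEg); exact: measurable_pair1.
have g2 y : measurable_fun setT (fun x => (g (x, y))%:E).
  by apply: (measurableT_comp mEg); exact: measurable_pair2.
have mbg1 : measurable_fun setT (fun z : T * T => (b z.1 * g z)%:E).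
  apply/measurable_EFinP; apply: measurable_funM => //.
  exact: (measurableT_comp mb measurable_fst).
have mbg2 : measurable_fun setT (fun z : T * T => (b z.2 * g z)%:E).
  apply/measurable_EFinP; apply: measurable_funM => //.
  exact: (measurableT_comp mb measurable_snd).
rewrite fubini_tonelli1//; last by move=> z; rewrite lee_fin mulr_ge0.
rewrite fubini_tonelli2//; last by move=> z; rewrite lee_fin mulr_ge0.
rewrite /fubini_F /fubini_G /=.
under eq_integral do under eq_integral do rewrite EFinM.
under [X in _ + X]eq_integral do under eq_integral do rewrite EFinM.
under eq_integral => x _.
  rewrite ge0_integralZl//; last 2 first.
  - by move=> y _; rewrite lee_fin.
  - by rewrite lee_fin.
  over.
under [X in _ + X]eq_integral => x _.
  rewrite ge0_integralZl//; last 2 first.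
  - by move=> y _; rewrite lee_fin.
  - by rewrite lee_fin.
  over.
have I1 x : 0 <= \int[nu]_y (g (x, y))%:E by apply: integral_ge0 => y _; rewrite lee_fin.
have I2 x : 0 <= \int[nu]_y (g (y, x))%:E by apply: integral_ge0 => y _; rewrite lee_fin.
rewrite -ge0_integralD//.
- by apply: eq_integral => x _; rewrite -ge0_muleDr ?I1 ?I2.
- by move=> x _; rewrite mule_ge0// lee_fin.
- apply: emeasurable_funM => //.
  by apply: (measurable_fun_fubini_tonelli_F (EFin \o g)) => // z; rewrite lee_fin.
- by move=> x _; rewrite mule_ge0// lee_fin.
- apply: emeasurable_funM => //.
  by apply: (measurable_fun_fubini_tonelli_G (EFin \o g)) => // z; rewrite lee_fin.
Qed.

Lemma ae_degree_fin_num g : L1 mu g -> {ae nu, forall x, degree g x \is a fin_num}.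
Proof.
move=> Ig; have := ae_integrable2 Ig; apply: filterS2 (ae_integrable1 Ig) => x.
by move=> I1 I2; rewrite /degree fin_numD !integrable_fin_num.
Qed.

(** By Fubini the left-hand side is the integral of the degree of [m] over [S], where the degree is
    at most 1 almost everywhere. *)
Lemma degree_le1_Rintegral m S : L1 mu m ->
  {ae nu, forall x, degree m x <= 1} -> measurable S ->
  (\int[mu]_(z in S `*` setT) m z + \int[mu]_(z in setT `*` S) m z
     <= fine (nu S))%R.
Proof.
move=> Im m1 mS.
have mST : measurable (S `*` [set: T]) by exact: measurableX.
have mTS : measurable ([set: T] `*` S) by exact: measurableX.
pose m_ (E : set (T * T)) := (m \* \1_E)%R.
have Im_ E : measurable E -> L1 mu (m_ E).
  move=> mE; apply: L1M => //.
  by move=> z; rewrite indicE; case: (_ \in _); rewrite ?normr0 ?normr1.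
have intE E : measurable E ->
    \int[mu]_(z in E) (m z)%:E = \int[mu]_z (m_ E z)%:E.
  move=> mE; rewrite integral_mkcond; apply: eq_integral => z _.
  rewrite /m_ /= indicE patchE; case: (z \in E); by rewrite ?mulr1 ?mulr0.
have F_ x : \int[nu]_y (m_ (S `*` setT) (x, y))%:E =
    (\1_S x)%:E * \int[nu]_y (m (x, y))%:E.
  have [xS|xS] := boolP (x \in S).
    rewrite indicE xS mul1e; apply: eq_integral => y _.
    by rewrite /m_ /= indicE in_setX/= xS in_setT mulr1.
  rewrite indicE (negbTE xS) mul0e; apply: integral0_eq => y _.
  by rewrite /m_ /= indicE in_setX/= (negbTE xS) mulr0.
have G_ x : \int[nu]_y (m_ (setT `*` S) (y, x))%:E =
    (\1_S x)%:E * \int[nu]_y (m (y, x))%:E.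
  have [xS|xS] := boolP (x \in S).
    rewrite indicE xS mul1e; apply: eq_integral => y _.
    by rewrite /m_ /= indicE in_setX/= xS in_setT mulr1.
  rewrite indicE (negbTE xS) mul0e; apply: integral0_eq => y _.
  by rewrite /m_ /= indicE in_setX/= (negbTE xS) andbF mulr0.
have IF := integrable_fubini_F (Im_ _ mST).
(* The absolute value of a column integral is at most the column integral of the absolute value,
   which has finite integral. *)
have IG : nu.-integrable setT (fubini_G nu (EFin \o m_ (setT `*` S))).
  have mm := measurable_int _ (Im_ _ mTS).
  apply/integrableP; split; first exact: (measurable_fubini_G (Im_ _ mTS)).
  have /(integrable21ltyP nu nu mm) := Im_ _ mTS; apply: le_lt_trans.
  apply: ge0_le_integral => //.
  - apply: measurableT_comp => //; exact: (measurable_fubini_G (Im_ _ mTS)).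
  - apply: (measurable_fun_fubini_tonelli_G (abse \o (EFin \o m_ (setT `*` S)))).
    + exact: measurableT_comp.
    + by move=> z; exact: abse_ge0.
  - move=> y _; apply: le_abse_integral => //.
    by apply: (measurableT_comp mm); exact: measurable_pair2.
rewrite -lee_fin EFinD /Rintegral.
rewrite !fineK; last 3 first.
- exact: fin_num_measure.
- by rewrite intE//; exact: (integrable_fin_num measurableT (Im_ _ mTS)).
- by rewrite intE//; exact: (integrable_fin_num measurableT (Im_ _ mST)).
rewrite !intE// -(integral12_prod_meas1 (Im_ _ mST)).
rewrite -(integral21_prod_meas1 (Im_ _ mTS)) -integralD//.
(* The sum of the sections equals [\1_S x * degree m x], which may be negative; passing to its
   positive part permits an almost-everywhere comparison of nonnegative functions with [\1_S]. *)
have IFG := integrableD measurableT IF IG.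
apply: (@le_trans _ _ (\int[nu]_x ((fubini_F nu (EFin \o m_ (S `*` setT)) \+
     fubini_G nu (EFin \o m_ (setT `*` S)))^\+ x))).
  apply: le_integral => //; first exact: integrable_funepos.
  by move=> x _; rewrite funeposE le_max lexx.
rewrite -[X in nu X](setIT S) -integral_indic//; apply: ae_ge0_le_integral => //.
- by apply: measurable_funepos; exact: measurable_int IFG.
- apply/measurable_EFinP; exact: measurable_indic.
apply: filterS m1 => x mx _.
rewrite funeposE ge_max lee_fin indicE ler0n andbT.
rewrite /fubini_F /fubini_G/= F_ G_ indicE.
by case: (x \in S); rewrite ?mul1e ?mul0e ?adde0.
Qed.

Lemma degree_rounding g m : (forall z, 0 <= g z)%R -> L1 mu g -> L1 mu m ->
  {ae nu, forall x, degree m x <= 1} ->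
  exists h : T * T -> R,
    [/\ measurable_fun setT h, forall z, (0 <= h z <= g z)%R,
       {ae nu, forall x, degree h x <= 1} &
       (L1norm mu (g \- h) <= 2 * cut nu (g \- m))%R].
Proof.
move=> g0 Ig Im m1.
have mg := L1_measurable Ig.
have mD := measurable_degree mg g0.
(* Where the degree is infinite, [fine] gives 0 and [c x] is 1; such points form a null set by
   [ae_degree_fin_num]. *)
pose c x : R := (Num.max 1 (fine (degree g x)))^-1%R.
have c01 x : (0 <= c x <= 1)%R.
  rewrite /c invr_ge0 le_max ler01/= invf_le1 ?lt_max ?ltr01//.
  by rewrite le_max lexx.
have c0 x : (0 <= c x)%R by have /andP[] := c01 x.
have c1 x : (c x <= 1)%R by have /andP[] := c01 x.
have mc : measurable_fun setT c.
  apply: (@measurable_fun_invr _ _ _ _ 1%R) => //.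
    by move=> x; rewrite le_max lexx.
  apply: measurable_maxr => //; apply: measurableT_comp mD.
  exact: fine_measurable.
pose h z := (c z.1 * c z.2 * g z)%R.
have mc1 : measurable_fun setT (fun z : T * T => c z.1).
  exact: (measurableT_comp mc measurable_fst).
have mc2 : measurable_fun setT (fun z : T * T => c z.2).
  exact: (measurableT_comp mc measurable_snd).
have mh : measurable_fun setT h.
  by apply: measurable_funM => //; exact: measurable_funM.
have h0 z : (0 <= h z)%R by rewrite mulr_ge0// mulr_ge0.
have hg z : (h z <= g z)%R by rewrite ler_piMl// mulr_ile1.
exists h; split => //; first by move=> z; rewrite h0 hg.
- apply: filterS (ae_degree_fin_num Ig) => x Dfin.
  have mEg : measurable_fun setT (EFin \o g) by exact/measurable_EFinP.
  have mEh : measurable_fun setT (EFin \o h) by exact/measurable_EFinP.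
  have D0 : 0 <= degree g x by exact: degree_ge0.
  (* The factor [c] of the other endpoint is at most 1 and is dropped; [c x] alone brings the degree
     at [x] down to at most 1. *)
  apply: (@le_trans _ _ ((c x)%:E * degree g x)).
    rewrite /degree ge0_muleDr; try by apply: integral_ge0 => y _; rewrite lee_fin.
    apply: leeD.
      rewrite -ge0_integralZl//.
      + apply: ge0_le_integral => //.
        * by move=> y _; rewrite lee_fin.
        * by apply: (measurableT_comp mEh); exact: measurable_pair1.
        * apply: emeasurable_funM => //.
          by apply: (measurableT_comp mEg); exact: measurable_pair1.
        * move=> y _; rewrite -EFinM lee_fin /h /= ler_wpM2r//.
          by rewrite ler_piMr.
      + by apply: (measurableT_comp mEg); exact: measurable_pair1.
      + by move=> y _; rewrite lee_fin.
      + by rewrite lee_fin.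
    rewrite -ge0_integralZl//.
    + apply: ge0_le_integral => //.
      * by move=> y _; rewrite lee_fin.
      * by apply: (measurableT_comp mEh); exact: measurable_pair2.
      * apply: emeasurable_funM => //.
        by apply: (measurableT_comp mEg); exact: measurable_pair2.
      * move=> y _; rewrite -EFinM lee_fin /h /= ler_wpM2r//.
        by rewrite ler_piMl.
    + by apply: (measurableT_comp mEg); exact: measurable_pair2.
    + by move=> y _; rewrite lee_fin.
    + by rewrite lee_fin.
  rewrite -(fineK Dfin) -EFinM lee_fin /c mulrC ler_pdivrMr ?lt_max ?ltr01//.
  by rewrite mul1r le_max lexx orbT.
pose a x := (1 - c x)%R.
have a0 x : (0 <= a x)%R by rewrite subr_ge0.
have ma : measurable_fun setT a by apply: measurable_funB.
pose S := [set x | 1 < degree g x].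
have mS : measurable S.
  by rewrite -[S]setTI; exact: emeasurable_fun_o_infty.
have I1 : L1 mu (fun z => a z.1 * g z)%R.
  apply: (L1_dominated _ _ Ig) => [|z].
    by apply: measurable_funM => //; exact: (measurableT_comp ma measurable_fst).
  by rewrite ger0_norm ?mulr_ge0// ler_piMl// lerBlDr lerDl.
have I2 : L1 mu (fun z => a z.2 * g z)%R.
  apply: (L1_dominated _ _ Ig) => [|z].
    by apply: measurable_funM => //; exact: (measurableT_comp ma measurable_snd).
  by rewrite ger0_norm ?mulr_ge0// ler_piMl// lerBlDr lerDl.
have Ih : L1 mu h.
  by apply: (L1_dominated _ _ Ig) => // z; rewrite ger0_norm.
(* For [s] and [t] in [0, 1], [1 - s * t <= (1 - s) + (1 - t)], because [(1 - s) * (1 - t) >= 0]. *)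
have gh_le : (L1norm mu (g \- h) <=
    \int[mu]_z (a z.1 * g z) + \int[mu]_z (a z.2 * g z))%R.
  rewrite -RintegralD//; apply: le_Rintegral => //.
  - exact/L1_norm/L1B.
  - exact: L1D I1 I2.
  - move=> z _ /=; rewrite ger0_norm ?subr_ge0// -mulrDl /h -[X in (X - _)%R]mul1r.
    rewrite -mulrBl ler_wpM2r// /a.
    by have := c01 z.1; have := c01 z.2; nra.
have mST : measurable (S `*` [set: T]) by exact: measurableX.
have mTS : measurable ([set: T] `*` S) by exact: measurableX.
have J1 : \int[mu]_z (\1_S z.1 * g z)%:E =
    (\int[mu]_(z in S `*` setT) g z)%:E.
  rewrite fineK; last first.
    by apply: integrable_fin_num => //; exact: integrableS Ig.
  rewrite [RHS]integral_mkcond; apply: eq_integral => z _.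
  rewrite patchE indicE in_setX in_setT andbT.
  by case: (_ \in S); rewrite ?mul1r ?mul0r.
have J2 : \int[mu]_z (\1_S z.2 * g z)%:E =
    (\int[mu]_(z in setT `*` S) g z)%:E.
  rewrite fineK; last first.
    by apply: integrable_fin_num => //; exact: integrableS Ig.
  rewrite [RHS]integral_mkcond; apply: eq_integral => z _.
  rewrite patchE indicE in_setX in_setT /=.
  by case: (_ \in S); rewrite ?mul1r ?mul0r.
(* Pointwise, [a x * degree g x + \1_S x <= \1_S x * degree g x]: for a finite degree [t > 1] both
   sides equal [t], for an infinite one the right side is infinite, and off [S] both sides
   vanish. *)
have excess : (\int[mu]_z (a z.1 * g z) + \int[mu]_z (a z.2 * g z)
    + fine (nu S) <=
    \int[mu]_(z in S `*` setT) g z + \int[mu]_(z in setT `*` S) g z)%R.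
  rewrite -lee_fin 3!EFinD -J1 -J2 integral_degree//.
  rewrite /Rintegral !fineK; last 3 first.
  - exact: fin_num_measure.
  - exact: (integrable_fin_num measurableT I2).
  - exact: (integrable_fin_num measurableT I1).
  rewrite integral_degree// -[X in nu X](setIT S) -integral_indic//.
  rewrite -ge0_integralD//; last 3 first.
  - by move=> x _; rewrite mule_ge0// ?lee_fin// degree_ge0.
  - by apply: emeasurable_funM => //; exact/measurable_EFinP.
  - exact/measurable_EFinP.
  apply: ge0_le_integral => //.
  - move=> x _; rewrite adde_ge0// ?lee_fin// mule_ge0// ?lee_fin// degree_ge0//.
  - apply: emeasurable_funD; last exact/measurable_EFinP.
    by apply: emeasurable_funM => //; exact/measurable_EFinP.
  - by apply: emeasurable_funM => //; exact/measurable_EFinP.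
  move=> x _; rewrite indicE; have [|] := boolP (x \in S).
    rewrite inE /S /= mul1e /a /c.
    case: (degree g x) => [t| |]//=.
      rewrite lte_fin => t1; rewrite (max_idPr (ltW t1)) -EFinM -EFinD lee_fin.
      by rewrite mulrBl mul1r mulVf ?subrK// gt_eqF// (lt_trans ltr01).
    by move=> _; rewrite leey.
  rewrite notin_setE /S /= => /negP; rewrite -leNgt mul0e adde0 => D1.
  have Dfin : degree g x \is a fin_num.
    by rewrite ge0_fin_numE ?degree_ge0// (le_lt_trans D1)// ltry.
  move: D1; rewrite -(fineK Dfin) lee_fin => D1.
  by rewrite /a /c (max_idPl D1) invr1 subrr mul0e.
have m_le := degree_le1_Rintegral Im m1 mS.
have Igm : L1 mu (g \- m)%R by exact: L1B.
(* Passing from [g] to [m] on the two rectangles costs one cut norm each, whence the factor 2;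
   [m_le] then cancels the mass of [S]. *)
have := le_cut Igm mS measurableT; have := le_cut Igm measurableT mS.
rewrite !RintegralB//; try exact: integrableS Ig; try exact: integrableS Im.
rewrite !ler_norml => /andP[_ cut1] /andP[_ cut2].
lra.
Qed.

End degree.

(** * The regularized quotient of the matching by the limit graphon *)

Section quotient.
Context {R : realType} {d : measure_display} {T : measurableType d}.
Variables (nu : probability T R) (W m : T * T -> R).
Local Notation mu := (nu \x nu)%E.
Hypothesis W_graphon : graphon W.
Hypothesis m_matching : matching nu W m.

Let mW : measurable_fun setT W. Proof. by case: W_graphon. Qed.
Let W0 z : 0 <= W z. Proof. by case: W_graphon => _ _ /(_ z)/andP[]. Qed.
Let Im : L1 mu m. Proof. by case: m_matching. Qed.

(* The regularization makes [m / W] integrable. *)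
Definition quotient (k : nat) (z : T * T) : R := `|m z| / (W z + k.+1%:R^-1).

Let Wk_gt0 k z : 0 < W z + k.+1%:R^-1.
Proof. by rewrite ltr_wpDl// invr_gt0. Qed.

(** The absolute value in [quotient] makes this hold at every point, whereas (M1) holds only almost
    everywhere. *)
Lemma quotient_ge0 k z : 0 <= quotient k z.
Proof. by rewrite divr_ge0// ltW. Qed.

Lemma ler_quotient j k z : (j <= k)%N -> quotient j z <= quotient k z.
Proof.
move=> jk; rewrite ler_wpM2l// lef_pV2 ?posrE ?Wk_gt0//.
by rewrite lerD2l lef_pV2 ?posrE// ler_nat.
Qed.

Let mquotient k : measurable_fun setT (quotient k).
Proof.
apply: measurable_funM.
  by apply: measurableT_comp => //; exact: L1_measurable Im.
apply: (@measurable_fun_invr _ _ _ _ k.+1%:R^-1) => [|z|].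
- by rewrite invr_gt0.
- by rewrite lerDr.
- exact: measurable_funD.
Qed.

Lemma L1_quotient k : L1 mu (quotient k).
Proof.
apply: (L1_dominated _ _ (L1Z k.+1%:R (L1_norm Im))) => // z.
rewrite ger0_norm ?quotient_ge0// [leRHS]mulrC ler_wpM2l//.
by rewrite invf_ple ?posrE ?Wk_gt0// lerDr.
Qed.

(** The factor [W / (W + 1 / (k + 1))] lies in [0, 1] and tends to 1 where [W] is nonzero; where [W]
    vanishes, so does [m] almost everywhere by (M2). Dominated convergence applies with bound
    [|m|]. *)
Lemma quotientM_cvg : L1norm mu ((quotient k \* W) \- m) @[k --> \oo] --> 0.
Proof.
apply: (@L1_dominated_cvg _ _ _ _ _ _ (fun z => `|m z|)).
- by move=> k; exact: measurable_funM.
- exact: L1_measurable Im.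
- move=> k z; rewrite /= normrM (ger0_norm (quotient_ge0 k z)) (ger0_norm (W0 z)).
  by rewrite /quotient -mulrA ler_piMr// mulrC ler_pdivrMr// mul1r lerDl.
- exact: L1_norm.
case: m_matching => _ m_ge0 m_supp _.
have m0 : {ae mu, forall z, W z = 0 -> m z = 0}.
  apply: negligibleS m_supp => z /= /not_implyP[Wz mz]; split.
    by apply/eqP.
  by rewrite /supp /= Wz eqxx.
apply: filterS2 m_ge0 m0 => z mz_ge0 mz0.
have [/eqP Wz|Wz] := boolP (W z == 0).
  rewrite mz0//= (_ : (fun k => _) = cst 0); first exact: cvg_cst.
  by apply/funext => k; rewrite /= Wz mulr0.
rewrite -[X in _ --> X](divfK Wz) -[X in X / _](ger0_norm mz_ge0).
apply: cvgMl; apply: cvgMr; apply: cvgV => //.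
rewrite -[X in _ --> X]addr0; apply: cvgD; first exact: cvg_cst.
exact: cvg_harmonic.
Qed.

End quotient.

(** * Rescaled kernels and the choice of the regularization index *)

Section rescaling.
Context {R : realType} {d : measure_display} {T : measurableType d}.
Variables (nu : probability T R) (Wn : nat -> T * T -> R) (W m : T * T -> R).
Local Notation mu := (nu \x nu)%E.
Hypothesis Wn_graphon : forall n, graphon (Wn n).
Hypothesis W_graphon : graphon W.
Hypothesis Wn_cvg : cut_norm nu (Wn n \- W) @[n --> \oo] --> 0%E.
Hypothesis m_matching : matching nu W m.

Let mW : measurable_fun setT W. Proof. by case: W_graphon. Qed.
Let mWn n : measurable_fun setT (Wn n). Proof. by case: (Wn_graphon n). Qed.
Let W01 z : 0 <= W z <= 1. Proof. by case: W_graphon. Qed.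
Let Wn01 n z : 0 <= Wn n z <= 1. Proof. by case: (Wn_graphon n). Qed.
Let Im : L1 mu m. Proof. by case: m_matching. Qed.

Let f := quotient W m.
Let If k : L1 mu (f k). Proof. exact: (L1_quotient W_graphon m_matching). Qed.

Let U n := Wn n \- W.
Let mU n : measurable_fun setT (U n). Proof. exact: measurable_funB. Qed.
Let U1 n z : `|U n z| <= 1.
Proof.
by rewrite ler_norml /U /=; have := W01 z; have := Wn01 n z; lra.
Qed.
Let U0 : cut nu (U n) @[n --> \oo] --> 0.
Proof. exact: fine_cvg Wn_cvg. Qed.

Let g k n := f k \* Wn n.
Let g_ge0 k n z : 0 <= g k n z.
Proof.
by have /andP[? _] := Wn01 n z; rewrite mulr_ge0//; exact: quotient_ge0.
Qed.
Let Ig k n : L1 mu (g k n).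
Proof.
apply: L1M => // z; have /andP[? ?] := Wn01 n z.
by rewrite ger0_norm.
Qed.
Let IfW k : L1 mu (f k \* W).
Proof. by apply: L1M => // z; have /andP[? ?] := W01 z; rewrite ger0_norm. Qed.

Let e k := L1norm mu ((f k \* W) \- m).
Let e_cvg0 : e k @[k --> \oo] --> 0. Proof. exact: quotientM_cvg. Qed.

Let C k n := cut nu (g k n \- m).

(** Splitting [Wn n] as [U n \+ W] leaves one term that vanishes as [n] grows with [k] fixed, and
    one that depends on [k] only. *)
Let CE k n : C k n <= cut nu (f k \* U n) + e k.
Proof.
have -> : C k n = cut nu ((f k \* U n) \+ ((f k \* W) \- m)).
  by congr cut; apply/funext => z; rewrite /g /U /=; lra.
have IfU : L1 mu (f k \* U n) by exact: L1M.
have IfWm : L1 mu ((f k \* W) \- m) by exact: L1B.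
by rewrite (le_trans (ler_cutD _ _))// lerD2l cut_le_L1norm.
Qed.

(* Since [f] is monotone in its index, the L1 distance is the absolute value of
   an integral over the whole space, which the cut norm controls. *)
Let L1normB_le j k n : L1norm mu (g k n \- g j n) <= C k n + C j n.
Proof.
wlog jk : j k / (j <= k)%N => [H|].
  have [jk|/ltnW kj] := leqP j k; first exact: H.
  by rewrite L1normB addrC; exact: H.
have -> : L1norm mu (g k n \- g j n) =
    \int[mu]_(z in setT `*` setT) (g k n z - m z) -
    \int[mu]_(z in setT `*` setT) (g j n z - m z).
  rewrite setXTT -RintegralB//; try by apply: L1B.
  apply: eq_Rintegral => z _; rewrite ger0_norm /=; first lra.
  have /andP[? _] := Wn01 n z; rewrite subr_ge0 ler_wpM2r//.
  exact: ler_quotient.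
have Igm i : L1 mu (g i n \- m) by exact: L1B.
rewrite (le_trans (ler_norm _))// (le_trans (ler_normB _ _))//.
by apply: lerD; apply: (le_cut (Igm _)).
Qed.

(** The cut norm tests rectangles only. For a general [A], [g (K n) n] is therefore compared in L1
    with [g j n] for a fixed [j], to which the multiplier lemmas apply. *)
Lemma rescaling_approximation : exists K : nat -> nat,
  cut nu (g (K n) n \- m) @[n --> \oo] --> 0 /\
  forall A : set (T * T), measurable A ->
    \int[mu]_(z in A) (g (K n) n \- m) z @[n --> \oo] --> 0.
Proof.
have /choice[K KP] n : exists k, forall j, (j <= n)%N -> C k n <= C j n.
  case: (@arg_minP _ _ _ (ord0 : 'I_n.+1) xpredT (fun i => C i n)) => //.
  move=> i _ iP; exists i => j; rewrite -ltnS => jn.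
  exact: (iP (Ordinal jn)).
(* Once [e j] is small for some fixed [j], this [j] competes in the minimum as soon as [j <= n]. *)
have CK0 : C (K n) n @[n --> \oo] --> 0.
  apply/cvgr0Pnorm_le => eps eps0.
  have eps2 : 0 < eps / 2 by rewrite divr_gt0.
  have /cvgr0Pnorm_le/(_ _ eps2)[j _ /(_ j (leqnn j))/=] := e_cvg0.
  rewrite ger0_norm ?L1norm_ge0// => ej.
  have /cvgr0Pnorm_le/(_ _ eps2) := cvg_cut_multiplier mU U1 U0 (If j).
  apply: filterS2 (nbhs_infty_ge j) => n jn.
  rewrite !ger0_norm ?cut_ge0// => cutj.
  by rewrite (le_trans (KP n j jn))// (le_trans (CE j n))// (splitr eps) lerD.
exists K; split => // A mA; apply/cvgr0Pnorm_le => eps eps0.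
(* The L1 distance from [g (K n) n] to [g j n] costs at most [2 * C j n], that is four sixths; the
   integral of [f j * U n] and [e j] cost one sixth each. *)
have eps6 : 0 < eps / 6 by rewrite divr_gt0.
have /cvgr0Pnorm_le/(_ _ eps6)[j _ /(_ j (leqnn j))/=] := e_cvg0.
rewrite ger0_norm ?L1norm_ge0// => ej.
have /cvgr0Pnorm_le/(_ _ eps6) HA := cvg_Rintegral_multiplier mU U1 U0 (If j) mA.
have /cvgr0Pnorm_le/(_ _ eps6) Hc := cvg_cut_multiplier mU U1 U0 (If j).
near=> n.
have Cj : C j n <= eps / 6 + e j.
  rewrite (le_trans (CE j n))// lerD2r -[leLHS]ger0_norm ?cut_ge0//.
  by near: n.
have CK : C (K n) n <= C j n by apply: KP; near: n; exact: nbhs_infty_ge.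
have AU : `|\int[mu]_(z in A) (f j z * U n z)| <= eps / 6 by near: n.
have Igg : L1 mu (g (K n) n \- g j n) by exact: L1B.
have IfU : L1 mu (f j \* U n) by exact: L1M.
have IfWm : L1 mu ((f j \* W) \- m) by exact: L1B.
have -> : \int[mu]_(z in A) (g (K n) n \- m) z =
    \int[mu]_(z in A) (g (K n) n \- g j n) z + \int[mu]_(z in A) (f j z * U n z) +
    \int[mu]_(z in A) ((f j \* W) \- m) z.
  rewrite -RintegralD//; [|exact: integrableS Igg|exact: integrableS IfU].
  rewrite -RintegralD//; [|exact: integrableS (L1D Igg IfU)|exact: integrableS IfWm].
  by apply: eq_Rintegral => z _; rewrite /g /U /=; lra.
have := normr_Rintegral_le_L1norm mA Igg.
have := normr_Rintegral_le_L1norm mA IfWm.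
have := L1normB_le j (K n) n.
rewrite -/(e j) !ler_norml in AU * => Hgg /andP[? ?] /andP[? ?].
move: AU => /andP[? ?]; apply/andP; split; lra.
Unshelve. all: by end_near.
Qed.

End rescaling.

(** * Rounding the rescaled kernels to matchings in the given graphons *)

Theorem corollary24 (R : realType) (d : measure_display) (T : measurableType d)
    (nu : probability T R)
    (T_borel : standard_borel R T)
    (nu_atomless : atomless nu)
    (Wn : nat -> T * T -> R) (W : T * T -> R)
    (Wn_graphon : forall n : nat, graphon (Wn n))
    (W_graphon : graphon W)
    (Wn_cvg : cut_norm nu (Wn n \- W) @[n --> \oo] --> 0%E)
    (m : T * T -> R)
    (m_matching : matching nu W m) :
  exists mn : nat -> T * T -> R,
    [/\ forall n : nat, matching nu (Wn n) (mn n),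
        cut_norm nu (mn n \- m) @[n --> \oo] --> 0%E &
        forall A : set (T * T), measurable A ->
          (\int[(nu \x nu)%E]_(z in A) (mn n z)%:E)%E @[n --> \oo] -->
          (\int[(nu \x nu)%E]_(z in A) (m z)%:E)%E].
Proof.
have [Im _ _ m_degree] := m_matching.
have [K [gK_cut gK_int]] :=
  rescaling_approximation Wn_graphon W_graphon Wn_cvg m_matching.
set g := fun n => quotient W m (K n) \* Wn n.
have Wn01 n z : 0 <= Wn n z <= 1 by case: (Wn_graphon n).
have g0 n z : 0 <= g n z.
  by have /andP[? _] := Wn01 n z; rewrite mulr_ge0//; exact: quotient_ge0.
have Ig n : L1 (nu \x nu)%E (g n).
  apply: L1M; first exact: (L1_quotient W_graphon m_matching).
    by case: (Wn_graphon n).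
  by move=> z; have /andP[? ?] := Wn01 n z; rewrite ger0_norm.
have /choice[h hP] n := degree_rounding (g0 n) (Ig n) Im m_degree.
have Ih n : L1 (nu \x nu)%E (h n).
  have [mh hg _ _] := hP n; apply: (L1_dominated mh _ (Ig n)) => z.
  by have /andP[? ?] := hg z; rewrite ger0_norm.
have Igm n : L1 (nu \x nu)%E (g n \- m) by exact: L1B.
have Ihg n : L1 (nu \x nu)%E (h n \- g n) by exact: L1B.
have Ihm n : L1 (nu \x nu)%E (h n \- m) by exact: L1B.
have hm n : h n \- m = (h n \- g n) \+ (g n \- m).
  by apply/funext => z /=; rewrite addrA subrK.
have hg_le n : L1norm (nu \x nu)%E (h n \- g n) <= 2 * cut nu (g n \- m).
  by have [_ _ _] := hP n; rewrite L1normB.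
exists h; split.
- move=> n; have [mh hg h_degree _] := hP n; split => //.
  + exact: Ih.
  + by apply: aeW => z; have /andP[] := hg z.
  (* Where [Wn n] vanishes, so does [g n], and [0 <= h n <= g n] forces [h n] to vanish too. *)
  + rewrite (_ : _ `\` _ = set0); first exact: negligible_set0.
    apply/seteqP; split => // z [/= hz /negP]; rewrite negbK => /eqP Wz.
    move: hz; rewrite /supp /=; have := hg z.
    by rewrite /g /= Wz mulr0 -eq_le eq_sym => ->.
- under eq_fun do rewrite cut_normE//.
  apply: cvg_EFin; first exact: nearW.
  apply: (squeeze_cvgr _ (cvg_cst 0)); last first.
    (* The rounding contributes 2 and the distance from [g n] to [m] contributes 1. *)
    by rewrite -[0](mulr0 3); apply: cvgMr gK_cut.
  apply: nearW => n /=; rewrite cut_ge0 hm (le_trans (ler_cutD _ _))//.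
  by have := cut_le_L1norm (Ihg n); have := hg_le n; rewrite -/(g n); lra.
- move=> A mA.
  have fin_int u : L1 (nu \x nu)%E u ->
      (\int[(nu \x nu)%E]_(z in A) (u z)%:E)%E =
      (\int[(nu \x nu)%E]_(z in A) u z)%:E.
    by move=> Iu; rewrite fineK//; apply: integrable_fin_num => //; exact: integrableS Iu.
  rewrite fin_int//; under eq_fun do rewrite fin_int//.
  apply: cvg_EFin; first exact: nearW.
  apply/subr_cvg0/norm_cvg0P.
  (* The L1 distance from [h n] to [g n] bounds the change of the integral over any [A]; the
     integral of [g n \- m] is handled by [gK_int]. *)
  apply: (squeeze_cvgr (h := fun n => 2 * cut nu (g n \- m) +
      `|\int[(nu \x nu)%E]_(z in A) (g n \- m) z|) _ (cvg_cst 0)); last first.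
    rewrite -[0]addr0; apply: cvgD; last by apply/norm_cvg0P; exact: gK_int.
    by rewrite -[0](mulr0 2); apply: cvgMr gK_cut.
  apply: nearW => n /=; rewrite normr_ge0 /= -RintegralB//;
    [|exact: integrableS (Ih n)|exact: integrableS Im].
  have -> : \int[(nu \x nu)%E]_(z in A) (h n z - m z) =
      \int[(nu \x nu)%E]_(z in A) (h n \- g n) z +
      \int[(nu \x nu)%E]_(z in A) (g n \- m) z.
    rewrite -RintegralD//; [|exact: integrableS (Ihg n)|exact: integrableS (Igm n)].
    by apply: eq_Rintegral => z _ /=; rewrite addrA subrK.
  rewrite (le_trans (ler_normD _ _))// lerD2r.
  exact: le_trans (normr_Rintegral_le_L1norm mA (Ihg n)) (hg_le n).
Qed.
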